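(* Let $\mathscr C$ be an extension closed variety of finite groups and let $m$ be an infinite cardinal number. Let $G$ be an $m$-quasifree pro-$\mathscr C$ group, and let $H$ be an open subgroup of $G$. Then $H$ is $m$-quasifree.
   Context: A variety of finite groups is a nonempty class $\mathscr C$ of finite groups closed under taking subgroups, finite direct products and homomorphic images; it is extension closed if it is moreover closed under extensions of groups. A pro-$\mathscr C$ group is an inverse limit of groups in $\mathscr C$. An epimorphism of groups is proper if it is not an isomorphism. A pro-$\mathscr C$ group $G$ is $m$-quasifree if whenever $A$ and $B$ are groups in $\mathscr C$, $\alpha\colon A\to B$ is a proper epimorphism of groups that splits (i.e. there is a homomorphism $\sigma\colon B\to A$ with $\alpha\sigma=\mathrm{id}_B$), and $\beta\colon G\to B$ is a continuous epimorphism, there exist precisely $m$ different continuous epimorphisms $\lambda\colon G\to A$ such that $\alpha\lambda=\beta$. *)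

(* Defs.v *)
From HB Require Import structures.
From mathcomp Require Import all_boot all_order all_fingroup.
From mathcomp Require Import all_classical topology.

Set Implicit Arguments.
Unset Strict Implicit.
Unset Printing Implicit Defensive.

Local Open Scope classical_set_scope.
Local Open Scope card_scope.
Local Open Scope group_scope.

HB.mixin Record isTopologicalGroup G & Topological G & monoid.Group G := {
  mulg_continuous : continuous (fun x : G * G => x.1 * x.2);
  invg_continuous : continuous (fun x : G => x^-1)
}.

#[short(type="topologicalGroupType")]
HB.structure Definition TopologicalGroup :=
  {G of Topological G & monoid.Group G & isTopologicalGroup G}.

(* A subgroup of [G], given as a predicate carrying the [groupClosed]
   structure, is a topological group for the topology induced by [G]. *)
Definition subgroup_of (G : topologicalGroupType) (H : groupClosed G) : Type :=
  {x : G | x \in H}.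

Section SubgroupOf.
Context (G : topologicalGroupType) (H : groupClosed G).

HB.instance Definition _ := SubChoice.on (subgroup_of H).

Let group_closedH : group_closed H.
Proof. by split; [exact: gpred1 | move=> x y; exact: gpredF]. Qed.

HB.instance Definition _ :=
  SubChoice_isSubGroup.Build G _ (subgroup_of H) group_closedH.

HB.instance Definition _ :=
  Topological.copy (subgroup_of H)
    (initial_topology (val : subgroup_of H -> G)).

Let val_continuous : continuous (val : subgroup_of H -> G).
Proof. exact: initial_continuous. Qed.

Let continuous_to (T : topologicalType) (f : T -> subgroup_of H) :
  continuous (val \o f) -> continuous f.
Proof.
move=> cf; apply/continuousP => _ [U oU <-].
by move/continuousP: cf => /(_ U oU).
Qed.

Let mul_cont :
  continuous (fun x : subgroup_of H * subgroup_of H => x.1 * x.2).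
Proof.
apply: continuous_to => -[a b].
have -> : val \o (fun x : subgroup_of H * subgroup_of H => x.1 * x.2) =
          (fun x : G * G => x.1 * x.2) \o
          (fun x : subgroup_of H * subgroup_of H => (val x.1, val x.2)).
  by apply/funext.
apply: continuous_comp; last exact: mulg_continuous.
by apply: cvg_pair; apply: (continuous_comp (f := _)) => //;
  [exact: cvg_fst | exact: val_continuous | exact: cvg_snd
  | exact: val_continuous].
Qed.

Let inv_cont : continuous (fun x : subgroup_of H => x^-1).
Proof.
apply: continuous_to => a.
have -> : val \o (fun x : subgroup_of H => x^-1) =
          (fun x : G => x^-1) \o val.
  by apply/funext.
apply: continuous_comp; [exact: val_continuous | exact: invg_continuous].
Qed.

HB.instance Definition _ :=
  isTopologicalGroup.Build (subgroup_of H) mul_cont inv_cont.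

End SubgroupOf.

Definition group_hom (G H : groupType) (f : G -> H) : Prop :=
  {morph f : x y / x * y}.

Definition group_epi (G H : groupType) (f : G -> H) : Prop :=
  group_hom f /\ set_surj [set: G] [set: H] f.

Definition proper_epi (G H : groupType) (f : G -> H) : Prop :=
  group_epi f /\ ~ bijective f.

Definition splits (G H : groupType) (f : G -> H) : Prop :=
  exists s : H -> G, group_hom s /\ cancel s f.

(* A class of finite groups is a predicate on [finGroupType]; closure under
   isomorphism is part of [variety_image]. *)
Record variety (C : finGroupType -> Prop) : Prop := Variety {
  variety_nonempty : exists A : finGroupType, C A;
  variety_subgroup : forall (A : finGroupType) (K : {group A}),
    C A -> C (subg_of K);
  variety_prod : forall A B : finGroupType, C A -> C B -> C (A * B)%type;
  variety_image : forall (A B : finGroupType) (f : A -> B),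
    group_epi f -> C A -> C B
}.

(* For [K <| [set: A]] the type [coset_of K] is the whole quotient of [A]
   by [K]. *)
Record extension_closed_variety (C : finGroupType -> Prop) : Prop :=
  ExtensionClosedVariety {
  extension_closed_is_variety : variety C;
  extension_closed : forall (A : finGroupType) (K : {group A}),
    K <| [set: A]%SET -> C (subg_of K) -> C (coset_of K) -> C A
}.

Definition directed (d : Order.disp_t) (I : porderType d) : Prop :=
  inhabited I /\
  forall i j : I, exists k : I, (i <= k)%O /\ (j <= k)%O.

Record inverse_system (d : Order.disp_t) (I : porderType d) := InverseSystem {
  inv_obj :> I -> finGroupType;
  inv_map : forall i j : I, (i <= j)%O -> inv_obj j -> inv_obj i;
  inv_map_hom : forall (i j : I) (ij : (i <= j)%O), group_hom (inv_map ij);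
  inv_map_id : forall (i : I) (ii : (i <= i)%O) x, inv_map ii x = x;
  inv_map_comp :
    forall (i j k : I) (ij : (i <= j)%O) (jk : (j <= k)%O) (ik : (i <= k)%O) x,
    inv_map ij (inv_map jk x) = inv_map ik x
}.

Section InverseLimit.
Context (d : Order.disp_t) (I : porderType d) (S : inverse_system I).

Definition inv_product : topologicalType :=
  prod_topology (fun i : I => discrete_topology (S i)).

Definition inverse_limit : set inv_product :=
  [set x | forall (i j : I) (ij : (i <= j)%O), inv_map ij (x j) = x i].

(* [G] is isomorphic, as a topological group, to the subgroup [inverse_limit]
   of the product with the induced topology: [phi] is a homomorphism (group
   operations of the product being componentwise) and a homeomorphism onto
   [inverse_limit]. *)
Definition is_inverse_limit (G : topologicalGroupType) : Prop :=
  exists phi : G -> inv_product,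
    [/\ forall i : I, group_hom (fun x : G => phi x i : S i),
        set_bij [set: G] inverse_limit phi,
        continuous phi
      & forall U : set G, open U ->
          exists2 V : set inv_product, open V & phi @` U = inverse_limit `&` V].

End InverseLimit.

Definition pro (C : finGroupType -> Prop) (G : topologicalGroupType) : Prop :=
  exists (d : Order.disp_t) (I : porderType d) (S : inverse_system I),
    [/\ directed I, forall i : I, C (S i) & is_inverse_limit S G].

Definition continuous_epi (G : topologicalGroupType) (A : finGroupType)
    (f : G -> A) : Prop :=
  group_epi f /\ continuous (f : G -> discrete_topology A).

(* The cardinal number [m] is represented by a type [M] of cardinality [m]. *)
Definition quasifree (C : finGroupType -> Prop) (M : Type)
    (G : topologicalGroupType) : Prop :=
  pro C G /\
  forall (A B : finGroupType) (alpha : A -> B) (beta : G -> B),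
    C A -> C B -> proper_epi alpha -> splits alpha -> continuous_epi beta ->
    [set lambda : G -> A | continuous_epi lambda /\ alpha \o lambda = beta]
      #= [set: M].

(* Main.v *)
Require Import Defs.
From HB Require Import structures.
From mathcomp Require Import all_boot all_order all_fingroup.
From mathcomp Require Import all_classical topology.

(** An epimorphism from [H] that lifts [beta] is manufactured from an
epimorphism of [G] onto a wreath product.  Let [alpha : A -> B] be a split
proper epimorphism in [C] and [beta : H -> B] a continuous epimorphism.  The
right cosets of the open subgroup [H] form a finite set [X], and for a finite
group [A] the wreath product [A wr X] is [A^X] extended by the permutations of
[X].  Induction turns a homomorphism [l : H -> A] into a homomorphism
[induced l : G -> A wr X] over the action of [G] on [X], and [l] is recovered
from it by restricting to [H], which fixes the coset [H] itself, and reading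
off the coordinate of [A^X] at that coset ([inducedK]).

Put [rho = induced beta : G -> B wr X].  The map [A wr X -> B wr X] given by
[alpha] on all coordinates is split, and the preimage [E] of the image [D] of
[rho] lies in [C]: [D] is a finite continuous quotient of [G], and the kernel
of [E -> D] is a power of the kernel of [alpha].  Quasifreeness of [G] provides
[m] continuous epimorphisms [G -> E] lifting [rho] ([wreath_lifts_card]), and
each of them restricts to a continuous epimorphism [H -> A] lifting [beta]
([restricted_lift]); surjectivity survives because the coordinate at the coset
[H] of an element of [E] may be changed freely within its fibre over [B].

A lift [psi] of [rho] is determined by its restriction together with the values
of its base coordinate at the finitely many coset representatives
([lift_from_restriction]).  Hence [m] lifts of [rho] give at least [m] lifts of
[beta]: split the [m] lifts into finitely many classes, on each of which
restriction is injective; since [m] is infinite, some class has [m] elements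
([square_pigeonhole]).  Conversely [l |-> induced l] injects the lifts of
[beta] into the continuous homomorphisms from [G] to a fixed finite group, and
there are at most [m] of those, since each is an epimorphism onto one of
finitely many subgroups ([quasifree_hom_card_le]).

The only infinite cardinal arithmetic required is [m * m <= m], and this comes
from quasifreeness itself: for a nontrivial [P] in [C] there are [m]
epimorphisms [G -> P], each with [m] lifts along the projection [P * P -> P],
while [G] has only [m] epimorphisms onto [P * P] ([quasifree_square]).

That [H] is again pro-C ([pro_open_subgroup]) uses that every open set around
the identity of an inverse limit contains the kernel of a single projection
([inverse_limit_open_kernel]); the same fact makes [X] finite and puts the
finite continuous quotients of [G] in [C]. *)

Set Implicit Arguments.
Unset Strict Implicit.
Unset Printing Implicit Defensive.

Local Open Scope group_scope.
Local Open Scope card_scope.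
Local Open Scope classical_set_scope.

(** * Homomorphisms of groups *)

Section Homs.
Context (G H : groupType) (f : G -> H).
Hypothesis fM : group_hom f.

Lemma hom1 : f 1 = 1.
Proof. by apply: (mulgI (f 1)); rewrite -fM !mulg1. Qed.

Lemma homV x : f x^-1 = (f x)^-1.
Proof. by apply: (mulgI (f x)); rewrite -fM !mulgV hom1. Qed.

Lemma hom_eq1_inj : (forall x, f x = 1 -> x = 1) -> injective f.
Proof.
move=> f1 x y fxy; rewrite -[x](mulgKV y).
by rewrite [_ * y^-1]f1 ?mul1g // fM homV fxy mulgV.
Qed.
End Homs.

Lemma group_epiP (G H : groupType) (f : G -> H) :
  group_hom f -> (forall y, exists x, f x = y) -> group_epi f.
Proof. by move=> fM fs; split=> // y _; have [x fx] := fs y; exists x. Qed.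

Lemma group_epi_surj (G H : groupType) (f : G -> H) :
  group_epi f -> forall y, exists x, f x = y.
Proof. by move=> [_ fs] y; have [//|x _ fx] := fs y; exists x. Qed.

Section Image.
Context (T : groupType) (P : finGroupType) (f : T -> P).

Definition hom_image : {set P} :=
  [set p : P | `[< exists t, f t = p >] ]%SET.

Lemma mem_hom_image p : reflect (exists t, f t = p) (p \in hom_image).
Proof. by rewrite inE; apply: asboolP. Qed.

Hypothesis fM : group_hom f.

Fact hom_image_group_set : group_set hom_image.
Proof.
apply/group_setP; split; first by apply/mem_hom_image; exists 1; exact: hom1.
move=> _ _ /mem_hom_image[x <-] /mem_hom_image[y <-].
by apply/mem_hom_image; exists (x * y).
Qed.

Definition hom_image_group : {group P} := Group hom_image_group_set.

Lemma hom_image_epi : group_epi (fun t => subg hom_image_group (f t)).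
Proof.
have fin t : f t \in hom_image by apply/mem_hom_image; exists t.
apply: group_epiP => [x y|u]; first by apply: val_inj; rewrite /= !subgK.
have /mem_hom_image[t ft] := subgP u.
by exists t; apply: val_inj; rewrite subgK.
Qed.
End Image.

(** * Varieties of finite groups *)

Section Variety.
Context (C : finGroupType -> Prop) (V : variety C).

(** The image [f T] is a subgroup of [P] and, as [ker f <= ker g], the group
[K] is a quotient of it.  The source [T] need not be finite: for a projection
[f] of a pro-C group this shows that its finite continuous quotients are in
[C]. *)
Lemma variety_subquotient (T : groupType) (P K : finGroupType)
    (f : T -> P) (g : T -> K) :
  C P -> group_hom f -> group_epi g -> (forall t, f t = 1 -> g t = 1) -> C K.
Proof.
move=> CP fM ge fg; have [gM _] := ge.
have /choice[r rK] : forall u : subg_of (hom_image_group fM),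
    exists t, f t = sgval u.
  by move=> u; exact/mem_hom_image/subgP.
have g_eq t t' : f t = f t' -> g t = g t'.
  move=> ftt'; rewrite -[t](mulgKV t') gM (fg (t * t'^-1)) ?mul1g //.
  by rewrite fM (homV fM) ftt' mulgV.
apply: (variety_image V (f := fun u => g (r u)) _ (variety_subgroup V _ CP)).
apply: group_epiP => [u v|k]; first by rewrite -gM; apply: g_eq; rewrite fM !rK.
have [t <-] := group_epi_surj ge k.
have ft : f t \in hom_image_group fM by apply/mem_hom_image; exists t.
by exists (Subg ft); apply: g_eq; rewrite rK.
Qed.

(** A group separated by finitely many homomorphisms to [A] embeds in a power
of [A]; the power is built one factor at a time along an enumeration of [X]. *)
Lemma variety_residual (A K : finGroupType) (X : finType) (ev : X -> K -> A) :
  C A -> (forall x, group_hom (ev x)) ->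
  (forall k, (forall x, ev x k = 1) -> k = 1) -> C K.
Proof.
move=> CA evM ev1.
have : forall s : seq X, exists P : finGroupType, C P /\
    exists2 f : K -> P, group_hom f & forall k, f k = 1 ->
      forall x, x \in s -> ev x k = 1.
  elim=> [|x s [P [CP [f fM fker]]]].
    by exists A; split => //; exists (fun=> 1) => // k k'; rewrite mulg1.
  exists (A * P)%type; split; first exact: (variety_prod V).
  exists (fun k => (ev x k, f k)) => [k k'|k [xk fk] y].
    by rewrite evM fM.
  by rewrite inE => /predU1P[-> //|]; exact: fker.
move=> /(_ (enum X)) [P [CP [f fM fker]]].
apply: (variety_subquotient (f := f) (g := id)) => //.
  by apply: group_epiP => // k; exists k.
by move=> k fk; apply: ev1 => x; apply: fker; rewrite ?mem_enum.
Qed.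

End Variety.

(** The kernel of [a] is in [C] because the maps [ev x] separate it, and the
section [s] identifies the quotient with [D].  Asking the [ev x] to be
multiplicative on the kernel only makes room for the coordinates of a wreath
product, which are multiplicative where the permutation part is trivial. *)
Lemma extension_closed_split (C : finGroupType -> Prop)
    (E D A : finGroupType) (a : E -> D) (s : D -> E)
    (X : finType) (ev : X -> E -> A) :
  extension_closed_variety C -> C D -> C A ->
  group_hom a -> group_hom s -> cancel s a ->
  (forall x e e', a e = 1 -> a e' = 1 -> ev x (e * e') = ev x e * ev x e') ->
  (forall e, a e = 1 -> (forall x, ev x e = 1) -> e = 1) -> C E.
Proof.
move=> [V ext] CD CA aM sM sK evM ev1.
pose K : {set E} := [set e | a e == 1]%SET.
have Kg : group_set K.
  apply/group_setP; split; first by rewrite inE (hom1 aM).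
  by move=> x y; rewrite !inE aM => /eqP-> /eqP->; rewrite mulg1.
have Ka (u : E) : u \in Group Kg -> a u = 1 by rewrite inE => /eqP.
have nK : Group Kg <| [set: E]%SET.
  rewrite /normal finset.subsetT; apply/fintype.subsetP => x _; rewrite inE.
  apply/fintype.subsetP => _ /imsetP[k kK ->]; rewrite inE /conjg !aM (homV aM).
  by rewrite (Ka _ kK) mul1g mulVg.
apply: (ext _ (Group Kg)) => //.
  apply: (variety_residual V
    (ev := fun x (u : subg_of (Group Kg)) => ev x (sgval u)) CA).
  - by move=> x u v; rewrite /= evM //; apply/Ka/subgP.
  - by move=> u ev_u; apply: val_inj; apply: ev1 => //; apply/Ka/subgP.
(* the section [s] makes [D] cover the quotient [E / K] *)
apply: (variety_image V (f := fun d => coset (Group Kg) (s d)) _ CD).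
have nKx x : x \in 'N(Group Kg).
  by apply: (fintype.subsetP (normal_norm nK)); rewrite inE.
apply: group_epiP => [x y|c]; first by rewrite sM morphM.
have [e ne ->] := cosetP c; exists (a e); apply/rcoset_kercosetP => //.
by rewrite mem_rcoset inE aM (homV aM) sK mulgV.
Qed.

(** * Continuity into discrete groups and into products *)

Lemma continuous_discreteP (X : topologicalType) (T : choiceType) (f : X -> T) :
  continuous (f : X -> discrete_topology T) <->
  forall a, open [set g | f g = a].
Proof.
split=> [cf a|fo].
  by move/continuousP: cf => /(_ [set a]); apply; exact: discrete_open.
move=> x; apply/discrete_cvg; apply: open_nbhs_nbhs.
by split => //; exact: fo.
Qed.

Lemma continuous_post (G : topologicalType) (A B : choiceType) (f : G -> A)
    (h : A -> B) : continuous (f : G -> discrete_topology A) ->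
  continuous ((fun g => h (f g)) : G -> discrete_topology B).
Proof.
move=> cf g; apply/discrete_cvg.
have near_f : nbhs g [set y | f y = f g].
  by apply: open_nbhs_nbhs; split=> //; move/continuous_discreteP: cf; apply.
suff : nbhs g [set y | h (f y) = h (f g)] by [].
by apply: filterS near_f => y /= ->.
Qed.

Lemma continuous_to_prod (T : topologicalType) (I : Type)
    (K : I -> topologicalType) (f : T -> prod_topology K) :
  (forall i, continuous (fun t => f t i : K i)) -> continuous f.
Proof.
move=> cf t; apply/cvg_sup => i A [_ [[W oW <-]] /= Wi /filterS]; apply.
exact: (cf i t W (open_nbhs_nbhs _)).
Qed.

Section TopologicalGroup.
Context (G : topologicalGroupType).

Lemma continuous_mulr (c : G) : continuous (fun x : G => x * c).
Proof.
move=> x.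
apply: (@continuous_comp _ _ _ (fun x : G => (x, c)) (fun p => p.1 * p.2)).
  by apply: cvg_pair; [exact: cvg_id | exact: cvg_cst].
exact: mulg_continuous.
Qed.

(** A homomorphism with a neighbourhood of [1] in its kernel is continuous; the
same argument works for maps that are not homomorphisms. *)
Lemma continuous_translation_invariant (T : choiceType) (f : G -> T)
    (U : set G) :
  nbhs 1 U -> (forall u g, U u -> f (u * g) = f g) ->
  continuous (f : G -> discrete_topology T).
Proof.
move=> U1 fU g; apply/discrete_cvg.
have : nbhs g ((fun x => x * g^-1) @^-1` U).
  by apply: continuous_mulr; rewrite mulgV.
by apply: filterS => x /= Ux; rewrite -[x](mulgKV g) fU.
Qed.

Lemma continuous_conj (c : G) : continuous (fun x : G => c * x * c^-1).
Proof.
move=> x.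
apply: (@continuous_comp _ _ _ (fun y => c * y) (fun y : G => y * c^-1)).
  apply: (@continuous_comp _ _ _ (fun y : G => (c, y)) (fun p => p.1 * p.2)).
    by apply: cvg_pair; [exact: cvg_cst | exact: cvg_id].
  exact: mulg_continuous.
exact: continuous_mulr.
Qed.

Lemma continuous_kernel_open (A : finGroupType) (f : G -> A) :
  continuous (f : G -> discrete_topology A) -> open [set g | f g = 1].
Proof. by move/continuous_discreteP. Qed.

End TopologicalGroup.

Section OpenSubgroup.
Context (G : topologicalGroupType) (H : groupClosed G).
Hypothesis H_open : open [set x : G | x \in H].

Lemma open_image_val (U : set (subgroup_of H)) : open U -> open (val @` U).
Proof.
move=> [O oO <-].
rewrite (_ : _ @` _ = O `&` [set x : G | x \in H]); first exact: openI.
apply/seteqP; split=> [_ [h Oh <-]|x [Ox Hx]]; first by split=> //; exact: valP.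
by exists (exist (fun x => x \in H) x Hx).
Qed.

Lemma continuous_val : continuous (val : subgroup_of H -> G).
Proof. exact: initial_continuous. Qed.

End OpenSubgroup.

(** * Finite quotients and open subgroups of pro-C groups *)

Section InverseLimitNeighbourhoods.
Context (G : topologicalGroupType).
Context (d : Order.disp_t) (I : porderType d) (S : inverse_system I).
Hypothesis dirI : directed I.
Context (phi : G -> inv_product S).
Hypotheses (phiM : forall i : I, group_hom (fun x : G => phi x i : S i))
  (phi_bij : set_bij [set: G] (inverse_limit (S:=S)) phi)
  (phi_open : forall U : set G, open U ->
    exists2 V : set (inv_product S),
      open V & phi @` U = inverse_limit (S:=S) `&` V).

(** The kernels of the projections form a basis of neighbourhoods of [1].
Since [I] is directed they generate a filter [F]; the image of [F] converges to
[phi 1] coordinate by coordinate, so [F] contains every open set around [1]. *)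
Lemma inverse_limit_open_kernel (U : set G) : open U -> U 1 ->
  exists i, forall g, phi g i = 1 :> S i -> U g.
Proof.
move=> oU U1; have [V oV phiU] := phi_open oU.
have compat g i j (ij : (i <= j)%O) : inv_map ij (phi g j) = phi g i.
  by have [+ _ _] := phi_bij => /(_ g Logic.I i j ij).
pose B (i : I) := [set g | phi g i = 1 :> S i].
pose F : set_system G := filter_from setT B.
have [[i0] dir] := dirI.
have FF : Filter F.
  apply: filter_from_filter; first by exists i0.
  move=> i j _ _; have [k [ik jk]] := dir i j; exists k => // g gk.
  by split; rewrite /B/= -(compat g _ _ ik, compat g _ _ jk) gk hom1 //;
    exact: inv_map_hom.
have phiF : phi @ F --> phi 1.
  apply/cvg_sup => i A [_ [[W oW <-]] /= Wi /filterS]; apply.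
  by exists i => // g gi; rewrite /= gi -(hom1 (@phiM i)).
have /phiF [i _ iV] : nbhs (phi 1) V.
  apply: open_nbhs_nbhs; split => //.
  by have [] : (inverse_limit (S:=S) `&` V) (phi 1) by rewrite -phiU; exists 1.
exists i => g gi.
have : (inverse_limit (S:=S) `&` V) (phi g).
  by split; [have [+ _ _] := phi_bij; apply | exact: iV].
rewrite -phiU => -[h Uh phgh].
by have [_ + _] := phi_bij => /(_ h g) <- //; rewrite inE.
Qed.

End InverseLimitNeighbourhoods.

Lemma pro_open_kernel (C : finGroupType -> Prop) (G : topologicalGroupType)
    (U : set G) : pro C G -> open U -> U 1 ->
  exists (Q : finGroupType) (p : G -> Q),
    [/\ C Q, group_hom p & forall g, p g = 1 -> U g].
Proof.
move=> [d [I [S [dirI CS [phi [phiM bij _ op]]]]]] oU U1.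
have [i iU] := inverse_limit_open_kernel dirI phiM bij op oU U1.
by exists (S i), (fun g => phi g i).
Qed.

Lemma pro_quotient (C : finGroupType -> Prop) (G : topologicalGroupType)
    (D : finGroupType) (f : G -> D) :
  variety C -> pro C G -> continuous_epi f -> C D.
Proof.
move=> V pG [fe cf]; have [fM _] := fe.
have [|Q [p [CQ pM pf]]] := pro_open_kernel pG (continuous_kernel_open cf).
  exact: hom1.
exact: (variety_subquotient V CQ pM fe).
Qed.

Section ImageSystem.
Context (d : Order.disp_t) (I : porderType d) (S : inverse_system I).
Context (K : groupType) (f : forall i : I, K -> S i).
Hypotheses (fM : forall i, group_hom (f i))
  (f_compat : forall (i j : I) (ij : (i <= j)%O) k, inv_map ij (f j k) = f i k).

Definition image_obj (i : I) : finGroupType := subg_of (hom_image_group (fM i)).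

Fact image_map_subproof (i j : I) (ij : (i <= j)%O) (u : image_obj j) :
  inv_map ij (sgval u) \in hom_image_group (fM i).
Proof.
have /mem_hom_image[k <-] := subgP u.
by apply/mem_hom_image; exists k; rewrite f_compat.
Qed.

Definition image_map (i j : I) (ij : (i <= j)%O) (u : image_obj j) :
    image_obj i :=
  Subg (image_map_subproof ij u).

Fact image_map_hom i j (ij : (i <= j)%O) : group_hom (image_map ij).
Proof. by move=> u v; apply: val_inj; rewrite /= inv_map_hom. Qed.

Fact image_map_id i (ii : (i <= i)%O) u : image_map ii u = u.
Proof. by apply: val_inj; rewrite /= inv_map_id. Qed.

Fact image_map_comp i j k (ij : (i <= j)%O) (jk : (j <= k)%O)
    (ik : (i <= k)%O) u :
  image_map ij (image_map jk u) = image_map ik u.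
Proof. by apply: val_inj; rewrite /= (inv_map_comp ij jk ik). Qed.

Definition image_system : inverse_system I :=
  InverseSystem image_map_hom image_map_id image_map_comp.
End ImageSystem.

(** [H] is the inverse limit of its images in the groups of the system.  A
compatible family in these images comes from some [g] in [G]; as [H] contains
the kernel of a single projection, and the image of [g] under that projection
is the image of an element of [H], the element [g] lies in [H]. *)
Lemma pro_open_subgroup (C : finGroupType -> Prop) (G : topologicalGroupType)
    (H : groupClosed G) :
  variety C -> open [set x : G | x \in H] -> pro C G -> pro C (subgroup_of H).
Proof.
move=> V oH [d [I [S [dirI CS [phi [phiM bij cphi op]]]]]].
have compat g i j (ij : (i <= j)%O) : inv_map ij (phi g j) = phi g i.
  by have [+ _ _] := bij => /(_ g Logic.I i j ij).
pose f i (h : subgroup_of H) : S i := phi (val h) i.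
have fM i : group_hom (f i) by move=> h h'; rewrite -phiM.
have f_compat i j (ij : (i <= j)%O) h : inv_map ij (f j h) = f i h.
  exact: compat.
have f_im i h : f i h \in hom_image_group (fM i).
  by apply/mem_hom_image; exists h.
exists d, I, (image_system fM f_compat); split=> //.
  by move=> i; exact: variety_subgroup.
pose psi (h : subgroup_of H) : inv_product (image_system fM f_compat) :=
  fun i => Subg (f_im i h).
exists psi; split.
- by move=> i h h'; apply: val_inj; rewrite /= fM.
- split.
  + by move=> h _ i j ij; apply: val_inj; exact: f_compat.
  + move=> h h' _ _ psih; apply: val_inj.
    have [_ + _] := bij => /(_ (val h) (val h')); apply; rewrite ?inE //.
    apply: functional_extensionality_dep => i.
    by have /(congr1 sgval) := congr1 (fun y => y i) psih.
  + move=> y yS.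
    have [_ _ surj] := bij.
    have [|g _ gy] := surj (fun i => sgval (y i)).
      by move=> i j ij; rewrite -(yS i j ij).
    have [i iH] := inverse_limit_open_kernel dirI phiM bij op oH gpred1.
    have /mem_hom_image[h fh] := subgP (y i).
    have gH : g \in H.
      rewrite -[g](mulgKV (val h)) gpredM ?(valP h) //; apply: iH.
      by rewrite phiM (homV (@phiM i)) gy -fh; exact: mulgV.
    exists (exist (fun x => x \in H) g gH) => //.
    apply: functional_extensionality_dep => j; apply: val_inj.
    by rewrite /= /f /= gy.
- apply: continuous_to_prod => i.
  have -> : (fun h => psi h i) =
            (fun h => subg (hom_image_group (fM i)) (f i h)).
    by apply/funext => h; apply: val_inj; rewrite subgK.
  apply: (continuous_post (h := subg (hom_image_group (fM i)))) => h.
  apply: (@continuous_comp _ _ _ (val : subgroup_of H -> G)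
    ((fun g => phi g i) : G -> discrete_topology (S i))).
    exact: continuous_val.
  apply: (@continuous_comp _ _ _ phi
    (fun x : inv_product S => x i : discrete_topology (S i))).
    exact: cphi.
  exact: (@proj_continuous I (fun i => discrete_topology (S i)) i).
- move=> U oU; have [W oW phiW] := op _ (open_image_val oH oU).
  exists [set y : inv_product (image_system fM f_compat) |
          W (fun i => sgval (y i))].
    apply: (open_comp (f := fun (y : inv_product (image_system fM f_compat)) =>
      (fun i => sgval (y i)) : inv_product S)) oW => y _.
    apply: continuous_to_prod => {y} i.
    apply: (continuous_post (h := sgval)).
    exact: (@proj_continuous I
      (fun i => discrete_topology (image_system fM f_compat i)) i).
  apply/seteqP; split=> [_ [h Uh <-]|y [yS Wy]].
    split; first by move=> i j ij; apply: val_inj; exact: f_compat.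
    have : [set phi x | x in val @` U] (phi (val h)).
      by exists (val h) => //; exists h.
    by rewrite phiW => -[].
  have : (inverse_limit (S:=S) `&` W) (fun i => sgval (y i)).
    by split=> // i j ij; rewrite -(yS i j ij).
  rewrite -phiW => -[_ [h Uh <-] phih]; exists h => //.
  apply: functional_extensionality_dep => i; apply: val_inj => /=.
  by rewrite /f phih.
Qed.

(** * A pigeonhole principle for infinite cardinals *)

Lemma card_leT_exP T U (B : set U) :
  [set: T] #<= B <-> exists f : T -> U, injective f /\ forall x, B (f x).
Proof.
split=> [/card_leP[g]|[f [finj fB]]].
  exists (fun x => val (g (SigSub (mem_set (Logic.I : [set: T] x))))).
  split=> [x y /val_inj gxy|x]; last exact: set_valP.
  by have /(congr1 val) := inj (mem_set Logic.I) (mem_set Logic.I) gxy.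
have fi : {in [set: T] &, injective f} by move=> x y _ _; exact: finj.
have /card_eqPle[_ le] := inj_card_eq fi.
by apply: card_le_trans le _; apply: subset_card_le => _ [x _ <-].
Qed.

Lemma card_leT_inP T U (A : set T) (u0 : U) :
  A #<= [set: U] <->
  exists f : T -> U, forall x y, A x -> A y -> f x = f y -> x = y.
Proof.
elim/Ppointed: U => U in u0 *; first by case: (no u0).
split=> [/pcard_injP[f fi]|[f fi]].
  by exists f => x y Ax Ay; apply: fi; rewrite inE.
by apply/pcard_injP; exists f => x y; rewrite !inE; exact: fi.
Qed.

Section Pigeonhole.
Context (M : Type) (pair : M * M -> M).
Hypothesis pair_inj : injective pair.

(** Place [M * M] inside [S].  Either some row [{a} * M] is contained in
[S1], or every row meets [S2] and choosing one point of [S2] in each row embeds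
[M]. *)
Lemma square_card_leU T (S S1 S2 : set T) : S `<=` S1 `|` S2 ->
  [set: M] #<= S -> [set: M] #<= S1 \/ [set: M] #<= S2.
Proof.
move=> S12 /card_leT_exP[e [einj eS]].
have [[a aS1]|noS1] := pselect (exists a, forall b, S1 (e (pair (a, b)))).
  left; apply/card_leT_exP; exists (fun b => e (pair (a, b))).
  by split=> // b b' /einj/pair_inj[].
right; have /choice[b bS2] : forall a, exists b, S2 (e (pair (a, b))).
  move=> a; apply: contrapT => noS2; apply: noS1; exists a => b.
  by case: (S12 _ (eS (pair (a, b)))) => // S2b; case: noS2; exists b.
apply/card_leT_exP; exists (fun a => e (pair (a, b a))).
by split=> // a a' /einj/pair_inj[].
Qed.

(** Split off the colours one at a time. *)
Lemma square_pigeonhole T (F : finType) (S : set T) (col : T -> F) :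
  [set: M] #<= S -> inhabited M ->
  exists u, [set: M] #<= S `&` [set t | col t = u].
Proof.
move=> MS [m0].
suff : forall (s : seq F) (S' : set T), [set: M] #<= S' ->
    (forall t, S' t -> col t \in s) ->
    exists u, [set: M] #<= S' `&` [set t | col t = u].
  by apply; [exact: MS | move=> t _; exact: (mem_enum F)].
elim=> [|u s IH] S' MS' S's.
  by have /card_leT_exP[e [_ eS']] := MS'; have := S's _ (eS' m0).
have cover :
    S' `<=` (S' `&` [set t | col t = u]) `|` (S' `&` [set t | col t != u]).
  by move=> t S't; have [?|?] := eqVneq (col t) u; [left|right].
have [|MS2] := square_card_leU cover MS'; first by exists u.
have [t [S't /= tu]|v Mv] := IH _ MS2.
  by have := S's _ S't; rewrite inE (negbTE tu).
by exists v; apply: card_le_trans Mv _; apply: subset_card_le => t [[]].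
Qed.
End Pigeonhole.

(** * Counting homomorphisms from a quasifree group *)

Section Quasifree.
Context (C : finGroupType -> Prop) (M : Type) (G : topologicalGroupType).
Hypotheses (C_ext : extension_closed_variety C) (G_qf : quasifree C M G).

Let V := extension_closed_is_variety C_ext.
Let pG : pro C G := proj1 G_qf.

(** Lift the trivial epimorphism along [P -> 1]. *)
Lemma quasifree_epi_card (P : finGroupType) (x : P) : C P -> x != 1 ->
  [set f : G -> P | continuous_epi f] #= [set: M].
Proof.
move=> CP x1; pose B := subg_of (one_group P).
have B1 (b : B) : b = 1.
  by apply: val_inj; have /set1P := subgP b.
have M1 (T : groupType) : group_hom (fun _ : T => 1 : B).
  by move=> ? ?; rewrite mulg1.
have e1 (T : groupType) : group_epi (fun _ : T => 1 : B).
  by apply: group_epiP => // b; exists 1; rewrite [b]B1.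
have CB : C B by exact: variety_subgroup.
have := G_qf.2 P B (fun=> 1) (fun=> 1) CP CB.
have -> : [set f : G -> P | continuous_epi f /\
                            (fun=> 1) \o f = (fun=> 1 : B)] =
          [set f : G -> P | continuous_epi f].
  by apply/seteqP; split => [f []|f] //.
apply.
- split=> // -[h hK _]; case/eqP: x1.
  by rewrite -[x]hK -[RHS]hK.
- by exists (fun=> 1); split=> [x0 y0|b]; [rewrite mulg1 | rewrite [b]B1].
- by split=> //; exact: cst_continuous.
Qed.

(** [b] enumerates the epimorphisms [G -> P], and [l a] enumerates the lifts of
[b a] along the first projection [P * P -> P]; the pair [(a, c)] is recovered
from the epimorphism [l a c] onto [P * P]. *)
Lemma quasifree_square (P : finGroupType) (x : P) : C P -> x != 1 ->
  exists pair : M * M -> M, injective pair.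
Proof.
move=> CP x1.
have CPP : C (P * P)%type by exact: (variety_prod V).
have /card_eqPle[_ /card_leT_exP[b [b_inj b_epi]]] := quasifree_epi_card CP x1.
have /choice[l lP] : forall a : M, exists l : M -> G -> P * P, injective l /\
    forall c, continuous_epi (l c) /\ fst \o l c = b a.
  move=> a.
  pose L := [set l : G -> (P * P)%type | continuous_epi l /\ fst \o l = b a].
  apply/(@card_leT_exP _ _ L).
  suff /card_eqPle[_ le] : L #= [set: M] by exact: le.
  apply: G_qf.2 => //.
  - split; first by apply: group_epiP => // p; exists (p, 1).
    move=> [h hK _]; case/eqP: x1.
    by have /= := hK (1, x); rewrite (hK (1, 1)) => -[].
  - by exists (fun p => (p, 1)); split=> // p q; congr (_, _); rewrite mulg1.
  - exact: b_epi.
have le : [set: M * M] #<= [set: M].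
  apply: (@card_le_trans _ _ _
    [set f : G -> (P * P)%type | continuous_epi f]).
    apply/card_leT_exP; exists (fun m => l m.1 m.2).
    split=> [[a c] [a' c'] /= ll|m]; last by have [_ /(_ m.2) []] := lP m.1.
    have aa' : a = a'.
      apply: b_inj; have [_ /(_ c) [_ <-]] := lP a.
      by have [_ /(_ c') [_ <-]] := lP a'; rewrite ll.
    by subst a'; have [/(_ _ _ ll) ->] := lP a.
  have x1' : (x, 1) != 1 :> (P * P)%type by apply: contra_neq x1 => -[].
  by have /card_eqPle[] := quasifree_epi_card CPP x1'.
by have /card_leT_exP[pair []] := le; exists pair.
Qed.

Hypothesis M_inf : infinite_set [set: M].

Lemma finite_card_le (F : finType) : exists j : F -> M, injective j.
Proof.
have /infiniteP/card_leT_exP[j [j_inj _]] := M_inf.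
by exists (fun x => j (enum_rank x)) => x y /j_inj/val_inj/enum_rank_inj.
Qed.

(** If there is an epimorphism at all then [P] is in [C], so either [P] is
nontrivial and [quasifree_epi_card] applies, or there is only one map. *)
Lemma quasifree_epi_card_le (P : finGroupType) :
  [set f : G -> P | continuous_epi f] #<= [set: M].
Proof.
have [m0 _] := infinite_setN0 M_inf.
have [[f0 f0_epi]|no_epi] := pselect (exists f : G -> P, continuous_epi f);
  last first.
  apply/(card_leT_inP _ m0); exists (fun=> m0) => f g ef.
  by case: no_epi; exists f.
have [[x x1]|P1] := pselect (exists x : P, x != 1).
  by have /card_eqPle[] := quasifree_epi_card (pro_quotient V pG f0_epi) x1.
apply/(card_leT_inP _ m0); exists (fun=> m0) => f g _ _ _.
have all1 (x : P) : x = 1.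
  by apply/eqP; apply: contrapT => /negP x1; apply: P1; exists x.
by apply/funext => t; rewrite [f t]all1 [g t]all1.
Qed.

(** A homomorphism is coded by its image, one of finitely many subgroups of
[W], together with its code among the epimorphisms onto that image.  The group
[P] is there to give the injection [M * M -> M] that merges the two. *)
Lemma quasifree_hom_card_le (P W : finGroupType) (x : P) : C P -> x != 1 ->
  [set f : G -> W | group_hom f /\
                    continuous (f : G -> discrete_topology W)] #<= [set: M].
Proof.
move=> CP x1; have [pair pair_inj] := quasifree_square CP x1.
have [k k_inj] := finite_card_le {group W}.
have m0 := k [1 W]%G.
have code (D : {group W}) : exists c : (G -> subg_of D) -> M,
    forall f g, continuous_epi f -> continuous_epi g -> c f = c g -> f = g.
  apply/(@card_leT_inP _ _ [set f : G -> subg_of D | continuous_epi f] m0).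
  exact: quasifree_epi_card_le.
pose c D := sval (cid (code D)); have c_inj D := svalP (cid (code D)).
apply/(card_leT_inP _ m0).
(* [1%G] is a dummy value: [im] is applied to homomorphisms only *)
pose im (f : G -> W) : {group W} :=
  if pselect (group_hom f) is left fM then hom_image_group fM else 1%G.
exists (fun f => pair (k (im f), c (im f) (fun g => subg (im f) (f g)))).
move=> f g [fM cf] [gM cg] /pair_inj[/k_inj im_fg].
have im_epi h : group_hom h -> continuous (h : G -> discrete_topology W) ->
    continuous_epi (fun t => subg (im h) (h t)) /\ forall t, h t \in im h.
  move=> hM ch; rewrite /im; case: pselect => // hM'; split.
    by split; [exact: hom_image_epi | exact: continuous_post].
  by move=> t; apply/mem_hom_image; exists t.
have [ef f_im] := im_epi _ fM cf; have [eg g_im] := im_epi _ gM cg.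
move: ef f_im; rewrite im_fg => ef f_im.
move=> /(c_inj _ _ _ ef eg) fg; apply/funext => t.
by rewrite -(@subgK _ (im g) (f t)) // (congr1 (fun h => h t) fg) subgK.
Qed.

End Quasifree.

(** Quasifreeness for a homomorphism [rho] that need not be onto, and for
groups [W] and [Z] that need not be in [C].  Replace [Z] by the image [D] of
[rho] and [W] by its preimage [E]: [D] is a finite quotient of [G], and [E] is
a split extension of [D] by the kernel of [a], which the maps [ev x] separate;
so both are in [C].  The section [s] restricts to a section of [E -> D]. *)
Lemma quasifree_split_lifts (C : finGroupType -> Prop) (M : Type)
    (G : topologicalGroupType) (W Z A : finGroupType) (X : finType)
    (a : W -> Z) (s : Z -> W) (ev : X -> W -> A) (rho : G -> Z) :
  extension_closed_variety C -> quasifree C M G -> C A ->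
  group_hom a -> group_hom s -> cancel s a ->
  (forall x w w', a w = 1 -> a w' = 1 -> ev x (w * w') = ev x w * ev x w') ->
  (forall w, a w = 1 -> (forall x, ev x w = 1) -> w = 1) ->
  (exists2 w, a w = 1 & w != 1) ->
  group_hom rho -> continuous (rho : G -> discrete_topology Z) ->
  [set: M] #<= [set psi : G -> W |
    [/\ group_hom psi, continuous (psi : G -> discrete_topology W),
        a \o psi = rho
      & forall w, (exists g, rho g = a w) -> exists g, psi g = w]].
Proof.
move=> Cext G_qf CA aM sM sK evM ev1 [w1 aw1 w1n] rhoM crho.
have V := extension_closed_is_variety Cext.
pose D := hom_image_group rhoM.
pose Es : {set W} := [set w | a w \in D]%SET.
have EsE w : (w \in Es) = (a w \in D) by rewrite finset.in_set.
have Eg : group_set Es.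
  apply/group_setP; split; first by rewrite EsE (hom1 aM) group1.
  by move=> x y; rewrite !EsE aM => ? ?; rewrite groupM.
pose E := Group Eg.
have aE (u : subg_of E) : a (sgval u) \in D by have := subgP u; rewrite EsE.
have sE (d : subg_of D) : s (sgval d) \in E by rewrite EsE sK subgP.
pose aa (u : subg_of E) : subg_of D := Subg (aE u).
pose ss (d : subg_of D) : subg_of E := Subg (sE d).
have aaM : group_hom aa by move=> u v; apply: val_inj; rewrite /= aM.
have ssM : group_hom ss by move=> u v; apply: val_inj; rewrite /= sM.
have ssK : cancel ss aa by move=> d; apply: val_inj; rewrite /= sK.
have rhoD g : rho g \in D by apply/mem_hom_image; exists g.
pose beta g : subg_of D := subg D (rho g).
have ebeta : continuous_epi beta.
  by split; [exact: hom_image_epi | exact: (continuous_post (h := subg D))].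
have CD : C (subg_of D) := pro_quotient V (proj1 G_qf) ebeta.
have aa1 u : aa u = 1 -> a (sgval u) = 1 by move=> /(congr1 sgval).
have CE : C (subg_of E).
  apply: (extension_closed_split
    (ev := fun x (u : subg_of E) => ev x (sgval u)) Cext CD CA aaM ssM ssK).
    by move=> x u v /aa1 au /aa1 av; rewrite evM.
  by move=> u /aa1 au ev_u; apply: val_inj; exact: ev1.
have /card_eqPle[_] :
    [set l : G -> subg_of E | continuous_epi l /\ aa \o l = beta] #= [set: M].
  apply: G_qf.2 => //; last by exists ss.
  split; first by apply: group_epiP => // d; exists (ss d).
  have w1E : w1 \in E by rewrite EsE aw1 group1.
  move=> [h hK _]; case/eqP: w1n.
  suff : Subg w1E = 1 by move=> /(congr1 sgval).
  rewrite -[LHS]hK -[RHS]hK; congr h; apply: val_inj.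
  by rewrite /= aw1 (hom1 aM).
move=> /card_leT_exP[l [l_inj lP]].
apply/card_leT_exP; exists (fun m g => sgval (l m g)); split=> [m m' lmm'|m].
  apply: l_inj; apply/funext => g; apply: val_inj.
  exact: (congr1 (fun f => f g) lmm').
have [[[lM ls] cl] al] := lP m; split.
- by move=> x y; rewrite lM.
- exact: (continuous_post (h := sgval)).
- apply/funext => g; have /(congr1 sgval) := congr1 (fun f => f g) al.
  by rewrite /= subgK.
- move=> w [g rg]; have wE : w \in E by rewrite EsE -rg.
  by have [//|g' _ lg] := ls (Subg wE); exists g'; rewrite lg.
Qed.

(** * Wreath products and induction from a subgroup of finite index *)

(** The group law below is chosen for the right action of [G] on right cosets:
[l (H_part (t * (g * g')))] is the product of [l (H_part (t * g))] and of the
coordinate of [g'] at the coset of [t * g].  The type has a name of its own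
because pairs already carry the componentwise group law. *)
Definition wreath (A : finGroupType) (X : finType) : Type :=
  ({ffun X -> A} * {perm X})%type.

Section Wreath.
Context (A : finGroupType) (X : finType).

HB.instance Definition _ := Finite.on (wreath A X).

Definition wreath_one : wreath A X := ([ffun=> 1], 1).
Definition wreath_mul (v w : wreath A X) : wreath A X :=
  ([ffun x => v.1 x * w.1 (v.2 x)], v.2 * w.2).
Definition wreath_inv (w : wreath A X) : wreath A X :=
  ([ffun x => (w.1 (w.2^-1 x))^-1], w.2^-1).

Lemma wreath_eqP (v w : wreath A X) : v.1 =1 w.1 -> v.2 = w.2 -> v = w.
Proof. by case: v w => [f p] [g q] /= /ffunP-> ->. Qed.

Fact wreath_mulA : associative wreath_mul.
Proof.
move=> u v w; apply: wreath_eqP => [x|] /=; last exact: mulgA.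
by rewrite !ffunE permM mulgA.
Qed.

Fact wreath_mul1 : left_id wreath_one wreath_mul.
Proof.
move=> w; apply: wreath_eqP => [x|] /=; last exact: mul1g.
by rewrite !ffunE perm1 mul1g.
Qed.

Fact wreath_mulV : left_inverse wreath_one wreath_inv wreath_mul.
Proof.
move=> w; apply: wreath_eqP => [x|] /=; last exact: mulVg.
by rewrite !ffunE mulVg.
Qed.

HB.instance Definition _ :=
  Finite_isGroup.Build (wreath A X) wreath_mulA wreath_mul1 wreath_mulV.

Lemma wreathM1 (v w : wreath A X) x : (v * w).1 x = v.1 x * w.1 (v.2 x).
Proof. by rewrite ffunE. Qed.

Lemma wreath11 x : (1 : wreath A X).1 x = 1.
Proof. by rewrite ffunE. Qed.

End Wreath.

Section WreathMap.
Context (A B : finGroupType) (X : finType) (h : A -> B).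

Definition wreath_map (w : wreath A X) : wreath B X :=
  ([ffun x => h (w.1 x)], w.2).

Lemma wreath_map_hom : group_hom h -> group_hom wreath_map.
Proof.
move=> hM v w; apply: wreath_eqP => [x|//].
by rewrite wreathM1 !ffunE hM.
Qed.
End WreathMap.

(** Representing the coset [H] by [1] makes the base coordinate of an induced
homomorphism restrict to the given one exactly, rather than up to an inner
automorphism. *)
Record transversal (G : topologicalGroupType) (H : groupClosed G) :=
  Transversal {
    coset_type :> finType;
    to_coset : G -> coset_type;
    coset_repr : coset_type -> G;
    to_cosetP : forall x y, to_coset x = to_coset y <-> x * y^-1 \in H;
    coset_reprK : cancel coset_repr to_coset;
    coset_repr1 : coset_repr (to_coset 1) = 1
  }.

Section Induction.
Context (G : topologicalGroupType) (H : groupClosed G) (T : transversal H).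

Lemma to_coset_mulr x y g :
  to_coset T x = to_coset T y -> to_coset T (x * g) = to_coset T (y * g).
Proof.
by move=> /to_cosetP Hxy; apply/to_cosetP; rewrite invgM -mulgA mulKVg.
Qed.

Lemma to_coset_mull (h : subgroup_of H) g :
  to_coset T (val h * g) = to_coset T g.
Proof. by apply/to_cosetP; rewrite mulgK; exact: valP. Qed.

Fact H_part_subproof g : g * (coset_repr (to_coset T g))^-1 \in H.
Proof. by apply/(to_cosetP T); rewrite coset_reprK. Qed.

(** The left factor of [g] in its decomposition along the representatives. *)
Definition H_part (g : G) : subgroup_of H :=
  exist (fun x => x \in H) _ (H_part_subproof g).

Lemma H_partK g : val (H_part g) * coset_repr (to_coset T g) = g.
Proof. by rewrite /= mulgKV. Qed.

Lemma H_partMl (h : subgroup_of H) g : H_part (val h * g) = h * H_part g.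
Proof. by apply: val_inj; rewrite /= to_coset_mull mulgA. Qed.

Lemma H_part_val (h : subgroup_of H) : H_part (val h) = h.
Proof.
apply: val_inj; rewrite /= -[val h]mulg1 to_coset_mull coset_repr1.
by rewrite invg1 !mulg1.
Qed.

Fact coset_perm_inj g : injective (fun x : T => to_coset T (coset_repr x * g)).
Proof.
by move=> x y /(to_coset_mulr g^-1); rewrite !mulgK !coset_reprK.
Qed.

Definition coset_perm g : {perm T} := perm (coset_perm_inj (g:=g)).

Lemma coset_permE g x : coset_perm g x = to_coset T (coset_repr x * g).
Proof. by rewrite permE. Qed.

Lemma coset_permM : {morph coset_perm : g g' / g * g'}.
Proof.
move=> g g'; apply/permP => x; rewrite permM !coset_permE mulgA.
by apply: to_coset_mulr; rewrite coset_reprK.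
Qed.

Lemma coset_perm_base (h : subgroup_of H) :
  coset_perm (val h) (to_coset T 1) = to_coset T 1.
Proof.
by rewrite coset_permE coset_repr1 mul1g -[val h]mulg1 to_coset_mull.
Qed.

Section Induced.
Context (A : finGroupType).

Definition induced (l : subgroup_of H -> A) (g : G) : wreath A T :=
  ([ffun x => l (H_part (coset_repr x * g))], coset_perm g).

Definition restricted (psi : G -> wreath A T) (h : subgroup_of H) : A :=
  (psi (val h)).1 (to_coset T 1).

Lemma inducedK l : restricted (induced l) = l.
Proof.
apply/funext => h; rewrite /restricted ffunE coset_repr1 mul1g.
by rewrite H_part_val.
Qed.

Lemma induced_hom l : group_hom l -> group_hom (induced l).
Proof.
move=> lM g g'; apply: wreath_eqP => [x|]; last exact: coset_permM.
rewrite wreathM1 !ffunE coset_permE -lM -H_partMl mulgA -[in RHS](mulgA).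
by congr (l (H_part _)); rewrite !mulgA H_partK.
Qed.

Lemma restricted_hom (psi : G -> wreath A T) :
  group_hom psi -> (forall g, (psi g).2 = coset_perm g) ->
  group_hom (restricted psi).
Proof.
move=> psiM psi2 h h'.
rewrite /restricted (_ : val (h * h') = val h * val h') //.
by rewrite psiM wreathM1 psi2 coset_perm_base.
Qed.

(** Let [t] represent [x], and write [t * g] as [h * t'] with [h] in [H] and
[t'] a representative.  The base coordinate of [psi (t * g)], computed from each
of the two factorisations, expresses coordinate [x] of [psi g] by the
restriction of [psi] to [H] and its base coordinates at the representatives. *)
Lemma lift_from_restriction (psi : G -> wreath A T) g x :
  group_hom psi -> (forall g, (psi g).2 = coset_perm g) ->
  (psi g).1 x = ((psi (coset_repr x)).1 (to_coset T 1))^-1 *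
    (restricted psi (H_part (coset_repr x * g)) *
     (psi (coset_repr (to_coset T (coset_repr x * g)))).1 (to_coset T 1)).
Proof.
move=> psiM psi2; apply: (canRL (mulKg _)).
have -> : (psi (coset_repr x)).1 (to_coset T 1) * (psi g).1 x =
          (psi (coset_repr x * g)).1 (to_coset T 1).
  by rewrite psiM wreathM1 psi2 coset_permE coset_repr1 mul1g coset_reprK.
by rewrite -[in LHS](H_partK (coset_repr x * g)) psiM wreathM1 psi2
  coset_perm_base.
Qed.
End Induced.
End Induction.

(** As [H] contains the kernel of [p], a coset of [H] is determined by its image
in [Q], and [Q] has finitely many subsets. *)
Lemma exists_transversal (G : topologicalGroupType) (H : groupClosed G)
    (Q : finGroupType) (p : G -> Q) :
  group_hom p -> (forall g, p g = 1 -> g \in H) ->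
  inhabited (transversal H).
Proof.
move=> pM pH.
pose k (g : G) : {set Q} :=
  [set q | `[< exists2 h, h \in H & q = p (h * g) >] ]%SET.
have memk q g : q \in k g <-> exists2 h, h \in H & q = p (h * g).
  by rewrite finset.in_set; split=> /asboolP.
have kP x y : k x = k y <-> x * y^-1 \in H.
  split=> [kxy|Hxy].
    have : p x \in k y.
      by rewrite -kxy; apply/memk; exists 1; rewrite ?gpred1 ?mul1g.
    move=> /memk[h hH pxh]; have : x * (h * y)^-1 \in H.
      by apply: pH; rewrite pM (homV pM) pxh mulgV.
    by rewrite invgM mulgA => /gpredM/(_ hH); rewrite mulgKV.
  apply/setP => q; apply/idP/idP => /memk[h hH ->]; apply/memk.
    exists (h * (x * y^-1)); first by rewrite gpredM.
    by rewrite !mulgA mulgKV.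
  exists (h * (x * y^-1)^-1); first by rewrite gpredM ?gpredV.
  by rewrite invgM invgK !mulgA mulgKV.
pose X : finType := {y : {set Q} | `[< exists g, k g = y >]}.
pose kappa g : X := exist (fun y => `[< exists g, k g = y >]) (k g)
  (asboolT (ex_intro _ g erefl)).
have /choice[t tK] : forall x : X, exists g, kappa g = x.
  by move=> [y ky]; have [g kg] := asboolW ky; exists g; exact: val_inj.
pose tau x := if x == kappa 1 then 1 else t x.
split; apply: (@Transversal _ _ X kappa tau); rewrite /tau.
- by move=> x y; rewrite -kP; split=> [/(congr1 val)//|kxy]; exact: val_inj.
- by move=> x; case: eqP => [->//|_].
- by rewrite eqxx.
Qed.

Section InducedContinuity.
Context (G : topologicalGroupType) (H : groupClosed G).
Hypothesis H_open : open [set x : G | x \in H].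
Context (T : transversal H).

(** The kernel of [induced l] contains the intersection of the finitely many
conjugates of the kernel of [l] by the coset representatives. *)
Lemma induced_continuous (A : finGroupType) (l : subgroup_of H -> A) :
  group_hom l -> continuous (l : _ -> discrete_topology A) ->
  continuous (induced T l : G -> discrete_topology (wreath A T)).
Proof.
move=> lM cl.
pose N : set G := val @` [set h | l h = 1].
have oN : open N by apply/open_image_val/continuous_kernel_open.
have N1 : N 1 by exists 1 => //=; exact: hom1.
apply: (@continuous_translation_invariant _ _ _
  [set u | forall x : T, N (coset_repr x * u * (coset_repr x)^-1)]).
  apply: filter_forall => x.
  apply: (continuous_conj (c := coset_repr x)); rewrite mulg1 mulgV.
  exact: open_nbhs_nbhs.
move=> u g Nu; rewrite induced_hom //.
suff -> : induced T l u = 1 by rewrite mul1g.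
have H1 (x : T) : H_part T (coset_repr x) = 1.
  by apply: val_inj; rewrite /= coset_reprK mulgV.
have reprM (x : T) : exists2 h : subgroup_of H,
    l h = 1 & coset_repr x * u = val h * coset_repr x.
  by have [h lh hE] := Nu x; exists h => //; rewrite hE mulgKV.
apply: wreath_eqP => [x|]; last first.
  apply/permP => x; rewrite coset_permE perm1.
  by have [h _ ->] := reprM x; rewrite to_coset_mull coset_reprK.
have [h lh hE] := reprM x.
by rewrite wreath11 ffunE hE H_partMl lM lh H1 (hom1 lM) mulg1.
Qed.
End InducedContinuity.

(** * Lifts from an open subgroup *)

Section Lifts.
Context (C : finGroupType -> Prop) (C_ext : extension_closed_variety C).
Context (M : Type) (M_inf : infinite_set [set: M]).
Context (G : topologicalGroupType) (G_qf : quasifree C M G).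
Context (H : groupClosed G) (H_open : open [set x : G | x \in H]).
Context (T : transversal H).
Context (A B : finGroupType) (a : A -> B) (s : B -> A) (b : subgroup_of H -> B).
Hypotheses (CA : C A) (a_epi : proper_epi a) (sM : group_hom s)
  (sK : cancel s a) (b_epi : continuous_epi b).

Let Lambda := [set l : subgroup_of H -> A | continuous_epi l /\ a \o l = b].
Let rho := induced T b.
(* the lifts of [rho] onto the preimage of its image *)
Let Psi := [set psi : G -> wreath A T |
    [/\ group_hom psi, continuous (psi : G -> discrete_topology _),
        wreath_map a (X := T) \o psi = rho
      & forall w, (exists g, rho g = wreath_map a w) -> exists g, psi g = w]].

Let aM : group_hom a. Proof. by case: a_epi => -[]. Qed.
Let bM : group_hom b. Proof. by case: b_epi => -[]. Qed.

Lemma proper_split_kernel : exists2 x, a x = 1 & x != 1.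
Proof.
apply: contrapT => noker; case: a_epi => _ []; exists s => //.
move=> x; apply: (hom_eq1_inj aM) => [y ay|]; last exact: sK.
by apply/eqP; apply: contrapT => /negP y1; apply: noker; exists y.
Qed.

Lemma wreath_lifts_card : [set: M] #<= Psi.
Proof.
have [x ax x1] := proper_split_kernel.
apply: (quasifree_split_lifts (s := wreath_map s (X := T)) (A := A)
  (ev := fun x w => w.1 x) C_ext G_qf CA).
- exact: wreath_map_hom.
- exact: wreath_map_hom.
- by move=> w; apply: wreath_eqP => // y; rewrite !ffunE.
- by move=> y w w' /(congr1 snd) /= w1 _; rewrite wreathM1 w1 perm1.
- move=> w /(congr1 snd) /= w2 w1; apply: wreath_eqP => // y.
  by rewrite wreath11.
- exists ([ffun=> x], 1).
    by apply: wreath_eqP => // y; rewrite !ffunE.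
  apply/eqP => /(congr1 (fun w : wreath A T => w.1 (to_coset T 1))).
  by rewrite wreath11 ffunE; exact/eqP.
- exact: induced_hom.
- by apply: induced_continuous => //; exact: b_epi.2.
Qed.

Lemma wreath_lift_perm psi g : Psi psi -> (psi g).2 = coset_perm T g.
Proof. by move=> [_ _ /(congr1 (fun f => (f g).2))]. Qed.

(** Surjectivity: given [y] in [A], take [h] with [b h = a y] and change the
base coordinate of a preimage of [rho (val h)] into [y].  The result is still in
the image of [psi], and it is the image of an element of [H]. *)
Lemma restricted_lift psi : Psi psi -> Lambda (restricted psi).
Proof.
move=> Ppsi; have psi2 g := wreath_lift_perm g Ppsi.
have [psiM cpsi apsi psi_onto] := Ppsi.
have rhoE g x : (rho g).1 x = a ((psi g).1 x).
  by rewrite -apsi /= ffunE.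
split; last first.
  apply/funext => h /=.
  rewrite -[RHS](congr1 (fun f => f h) (inducedK T b)).
  by rewrite /restricted -/rho rhoE.
split; last first.
  suff cpsi_val : continuous ((fun h => psi (val h)) :
      subgroup_of H -> discrete_topology (wreath A T)).
    exact: (continuous_post
      (h := fun w : wreath A T => w.1 (to_coset T 1)) cpsi_val).
  move=> h; apply: (@continuous_comp _ _ _ (val : subgroup_of H -> G)
    (psi : G -> discrete_topology (wreath A T))); last exact: cpsi.
  exact: continuous_val.
apply: group_epiP => [|y]; first exact: restricted_hom.
have [h bh] := group_epi_surj b_epi.1 (a y).
have rhoh : (rho (val h)).1 (to_coset T 1) = b h.
  exact: (congr1 (fun f => f h) (inducedK T b)).
(* an element over [rho (val h)] with base coordinate [y] *)
pose w : wreath A T :=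
  ([ffun x => if x == to_coset T 1 then y else s ((rho (val h)).1 x)],
   (rho (val h)).2).
have rhow : rho (val h) = wreath_map a w.
  apply: wreath_eqP => // x; rewrite [RHS]ffunE [w.1 x]ffunE.
  by case: eqP => [->|_]; rewrite ?sK // rhoh.
have [|g psig] := psi_onto w; first by exists (val h).
(* [g] permutes the cosets as [val h] does, so it fixes the base coset *)
have gH : g \in H.
  rewrite -[g]mulg1 -invg1; apply/(to_cosetP T).
  rewrite -{1}[g]mul1g -{1}(coset_repr1 T) -(@coset_permE _ _ T) -psi2 psig /=.
  exact: coset_perm_base.
exists (exist (fun x => x \in H) g gH).
by rewrite /restricted /= psig ffunE eqxx.
Qed.

(** Colour a lift by its base coordinates at the representatives.  Among lifts
of the same colour, [restricted] is injective. *)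
Lemma lifts_card_ge : [set: M] #<= Lambda.
Proof.
have [x ax x1] := proper_split_kernel.
have [pair pair_inj] := quasifree_square C_ext G_qf CA x1.
have [m0 _] := infinite_setN0 M_inf.
pose col (psi : G -> wreath A T) : {ffun T -> A} :=
  [ffun x => (psi (coset_repr x)).1 (to_coset T 1)].
have [u /card_leT_exP[e [e_inj eP]]] :=
  square_pigeonhole pair_inj col wreath_lifts_card (inhabits m0).
apply/card_leT_exP; exists (fun m => restricted (e m)).
split=> [m m' rmm'|m]; last by apply: restricted_lift; exact: (eP m).1.
have [P colm] := eP m; have [P' colm'] := eP m'.
have base_eq (y : T) : (e m (coset_repr y)).1 (to_coset T 1) =
                       (e m' (coset_repr y)).1 (to_coset T 1).
  by move/ffunP/(_ y): (etrans colm (esym colm')); rewrite !ffunE.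
apply: e_inj; apply/funext => g; apply: wreath_eqP => [y|]; last first.
  by rewrite !wreath_lift_perm.
have p2 i := wreath_lift_perm i P; have p2' i := wreath_lift_perm i P'.
have [eM _ _ _] := P; have [eM' _ _ _] := P'.
rewrite (lift_from_restriction _ _ eM p2) (lift_from_restriction _ _ eM' p2').
by rewrite rmm' !base_eq.
Qed.

Lemma lifts_card_le : Lambda #<= [set: M].
Proof.
have [x ax x1] := proper_split_kernel.
apply: card_le_trans
  (quasifree_hom_card_le C_ext G_qf M_inf (wreath A T) CA x1).
have fi : {in Lambda &, injective (fun l => induced T l)}.
  move=> l l' _ _ /(congr1 (@restricted _ H T A)).
  by rewrite !inducedK.
have /card_eqPle[_ le] := inj_card_eq fi.
apply: card_le_trans le _; apply: subset_card_le => _ [l [[[lM _] cl] _] <-].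
by split; [exact: induced_hom | exact: induced_continuous].
Qed.

End Lifts.

Theorem theorem5p1p1 (C : finGroupType -> Prop)
    (C_ext : extension_closed_variety C)
    (M : Type) (M_infinite : infinite_set [set: M])
    (G : topologicalGroupType) (G_quasifree : quasifree C M G)
    (H : groupClosed G) (H_open : open [set x : G | x \in H]) :
  quasifree C M (subgroup_of H).
Proof.
have V := extension_closed_is_variety C_ext; have [pG _] := G_quasifree.
split; first exact: pro_open_subgroup.
move=> A B a b CA CB a_epi [s [sM sK]] b_epi.
have [Q [p [_ pM pH]]] := pro_open_kernel pG H_open gpred1.
have [T] := exists_transversal pM pH.
apply: Cantor_Bernstein.
  exact: (lifts_card_le C_ext M_infinite G_quasifree H_open T b CA
    a_epi sK).
exact: (lifts_card_ge C_ext M_infinite G_quasifree H_open T CA a_epi sM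
  sK b_epi).
Qed.
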